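(* Let $A\in\mathbb{R}^{n\times n}$ be a matrix diagonalizable over $\mathbb{C}$. Then there exists an integer $s>n$ and a generic cut-and-project scheme $\Lambda=(\mathcal{L}\subset\mathbb{R}^s,\mathbb{R}^n)$ such that $A$ is a self-similarity of $\Lambda$ if and only if every eigenvalue of $A$ is an algebraic integer.
   Context: A lattice $\mathcal{L}\subset\mathbb{R}^s$ is a set $\{L\mathbf{r}:\mathbf{r}\in\mathbb{Z}^s\}$ for a non-singular $L\in\mathbb{R}^{s\times s}$, called a matrix associated to $\mathcal{L}$. For $1\le n<s$, the cut-and-project scheme $\Lambda=(\mathcal{L}\subset\mathbb{R}^s,\mathbb{R}^n)$ consists of $\mathcal{L}$ together with the projections $\pi_\parallel(\mathbf{x})=(x_1,\dots,x_n)^\top\in\mathbb{R}^n$ and $\pi_\perp(\mathbf{x})=(x_{n+1},\dots,x_s)^\top\in\mathbb{R}^{s-n}$. The scheme is non-degenerate if $\pi_\parallel$ restricted to $\mathcal{L}$ is injective, aperiodic if $\pi_\perp$ restricted to $\mathcal{L}$ is injective, irreducible if $\pi_\perp(\mathcal{L})$ is dense in $\mathbb{R}^{s-n}$, and generic if all three hold. A linear map (matrix) $A\in\mathbb{R}^{n\times n}$ is a self-similarity of a generic scheme $\Lambda$ with associated matrix $L$ if $A\pi_\parallel(\mathcal{L})\subset\pi_\parallel(\mathcal{L})$ and there exist $C\in\mathbb{Z}^{s\times s}$ and $B\in\mathbb{R}^{(s-n)\times(s-n)}$ with $\begin{pmatrix}A&O\\O&B\end{pmatrix}L=LC$. *)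

(* Defs.v *)
From HB Require Import structures.
From mathcomp Require Import all_boot all_order all_algebra.
From mathcomp Require Import all_classical all_reals all_analysis.
From mathcomp Require Import complex.
Import numFieldNormedType.Exports.
Set Implicit Arguments. Unset Strict Implicit. Unset Printing Implicit Defensive.
Import Order.TTheory GRing.Theory Num.Theory.
Local Open Scope ring_scope.
Local Open Scope classical_set_scope.

(* Points of the lattice L Z^s, s = n + m, with L : 'M[R]_(n+m);
   lattice vectors are columns; r : 'cV[int]_(n+m) is an integer vector. *)
Definition lpt (R : realType) (n m : nat) (L : 'M[R]_(n + m))
  (r : 'cV[int]_(n + m)) : 'cV[R]_(n + m) := L *m map_mx intr r.

Definition pi_par (R : realType) (n m : nat) (x : 'cV[R]_(n + m)) : 'cV[R]_n :=
  usubmx x.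
Definition pi_perp (R : realType) (n m : nat) (x : 'cV[R]_(n + m)) : 'cV[R]_m :=
  dsubmx x.

(* The lattice is given by a non-singular associated matrix L. *)
Definition nonsingular (R : realType) (k : nat) (L : 'M[R]_k) : Prop :=
  \det L != 0.

Definition non_degenerate (R : realType) (n m : nat) (L : 'M[R]_(n + m)) :=
  forall r1 r2, pi_par (lpt L r1) = pi_par (lpt L r2) -> lpt L r1 = lpt L r2.

Definition aperiodic (R : realType) (n m : nat) (L : 'M[R]_(n + m)) :=
  forall r1 r2, pi_perp (lpt L r1) = pi_perp (lpt L r2) -> lpt L r1 = lpt L r2.

Definition irreducible_cps (R : realType) (n m : nat) (L : 'M[R]_(n + m)) :=
  dense [set pi_perp (lpt L r) | r in [set: 'cV[int]_(n + m)]].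

Definition generic_cps (R : realType) (n m : nat) (L : 'M[R]_(n + m)) :=
  [/\ non_degenerate L, aperiodic L & irreducible_cps L].

Definition self_similarity (R : realType) (n m : nat) (L : 'M[R]_(n + m))
  (A : 'M[R]_n) : Prop :=
  (forall r, exists r', A *m pi_par (lpt L r) = pi_par (lpt L r'))
  /\ exists (C : 'M[int]_(n + m)) (B : 'M[R]_m),
       block_mx A 0 0 B *m L = L *m map_mx intr C.

Definition algebraic_integer (F : fieldType) (z : F) : Prop :=
  exists p : {poly int}, p \is monic /\ root (map_poly intr p) z.

Definition cplx_mx (R : realType) (n : nat) (A : 'M[R]_n) : 'M[R[i]]_n :=
  map_mx (real_complex R) A.

(* Main.v *)
(** Proof idea.  If diag(A, B) L = L C, a left eigenvector of A gives one of the
    integer matrix C, so eigenvalues of A are roots of a monic integer polynomial.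

    Conversely, let f be the minimal polynomial of D = A^T over Q; it lies in Z[x],
    and it is separable because A is diagonalizable.  Z^s is taken to be
    (Z[x]/f)^k with k = 2n, on which x acts by a block-diagonal integer matrix C.
    A k-tuple of vectors v_i gives an intertwiner pi : (R[x]/f)^k -> R^n,
    (g_i) |-> sum_i v_i g_i(D), and a k-tuple of covectors psi_i gives
    sigma : R^n -> (R[x]/f)^k.  When sigma pi is invertible, R^s splits C-invariantly
    into the image of sigma and the kernel of pi, and L^T = [pi | Q] where the
    columns of Q span the kernel of sigma.  For v_i and psi_i avoiding countably
    many proper subspaces, no nonzero integer vector is killed by pi, lies in the
    image of sigma, or is killed by sigma on the right; these three facts are
    non-degeneracy, aperiodicity and, by Kronecker's theorem (a subgroup of R^m
    on which no nonzero linear form is integral is dense), irreducibility. *)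
Require Import Defs.
From HB Require Import structures.
From mathcomp Require Import all_boot all_order all_algebra.
From mathcomp Require Import all_field zify ring lra.
From mathcomp Require Import all_classical all_reals all_analysis.
From mathcomp Require Import complex.
Import numFieldNormedType.Exports.
Import Order.TTheory GRing.Theory Num.Theory.
Set Implicit Arguments. Unset Strict Implicit. Unset Printing Implicit Defensive.
Local Open Scope ring_scope.

(** * Kronecker's density theorem *)

(** Pigeonhole: [K.+1 ^ m + 1] multiples of [y], taken modulo 1, fall into [K.+1 ^ m] boxes of side
    [K.+1%:R^-1]; two share a box, and [q] is the difference of their multipliers. *)
Lemma dirichlet_simultaneous (R : realType) (m K : nat) (y : 'rV[R]_m) :
  exists q : nat, exists p : 'rV[int]_m,
    [/\ (0 < q)%N, (q <= K.+1 ^ m)%N &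
        forall j, `|q%:R * y 0 j - (p 0 j)%:~R| < K.+1%:R^-1].
Proof.
pose frac (a : nat) j : R := a%:R * y 0 j - (Num.floor (a%:R * y 0 j))%:~R.
have frac01 a j : 0 <= frac a j < 1.
  rewrite /frac subr_ge0 floor_le ltrBlDr addrC.
  by have := floorD1_gt (a%:R * y 0 j); rewrite intrD.
have K0 : 0 < K.+1%:R :> R by rewrite ltr0n.
pose box (a : 'I_(K.+1 ^ m).+1) : {ffun 'I_m -> 'I_K.+1} :=
  [ffun j => inord (Num.truncn (K.+1%:R * frac a j))].
have boxE (a : 'I_(K.+1 ^ m).+1) j :
    (box a j)%:R <= K.+1%:R * frac a j < (box a j)%:R + 1.
  have /andP[f0 f1] := frac01 a j.
  have Kf0 : 0 <= K.+1%:R * frac a j by rewrite mulr_ge0 // ltW.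
  rewrite ffunE inordK; last first.
    by rewrite truncn_lt_nat // gtr_pMr.
  by rewrite natr1; exact: truncn_itv.
have : ~ injective box.
  by move=> /leq_card; rewrite card_ffun !card_ord ltnn.
move=> /injectiveP /injectivePn [a [b ab Eab]].
wlog {ab} ab : a b Eab / (a < b)%N.
  move=> H; case: (ltngtP a b) => [|ba|E]; first exact: H.
  - exact: (H b a).
  - by move: ab; rewrite -val_eqE /= E eqxx.
exists (b - a)%N, (\row_j (Num.floor (b%:R * y 0 j) - Num.floor (a%:R * y 0 j))).
split; first by rewrite subn_gt0.
  by apply: leq_trans (leq_subr _ _) _; rewrite -ltnS ltn_ord.
move=> j; rewrite mxE natrB ?(ltnW ab) // intrB.
have -> : (b%:R - a%:R) * y 0 j -
    ((Num.floor (b%:R * y 0 j))%:~R - (Num.floor (a%:R * y 0 j))%:~R) =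
    frac b j - frac a j by rewrite /frac; ring.
have := boxE b j; rewrite -Eab; have := boxE a j.
move: (box a j)%:R (frac a j) (frac b j) => c fa fb /andP[a1 a2] /andP[b1 b2].
have K1 : K.+1%:R^-1 * K.+1%:R = 1 :> R by rewrite mulVf ?gt_eqF.
rewrite -(ltr_pM2l K0) mulfV ?gt_eqF // -[X in X * `|_|]gtr0_norm // -normrM.
rewrite ltr_norml mulrBr; apply/andP; split; lra.
Qed.

Section Subgroup.
Variables (R : realType) (m : nat) (G : set 'rV[R]_m).
Hypotheses (G0 : G 0) (GB : forall x y, G x -> G y -> G (x - y)).

Lemma subgroup_add x y : G x -> G y -> G (x + y).
Proof. by move=> Gx Gy; rewrite -[y]opprK -[- y]sub0r; exact/GB/GB. Qed.

Lemma subgroup_mulrz (z : int) x : G x -> G (z%:~R *: x).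
Proof.
move=> Gx; have Gn k : G (k%:R *: x).
  elim: k => [|k IH]; first by rewrite scale0r.
  by rewrite -natr1 scalerDl scale1r; exact: subgroup_add.
case: z => k; first exact: Gn.
by rewrite NegzE intrN scaleNr -sub0r; apply: GB => //; exact: Gn.
Qed.

Lemma subgroup_lincomb k (M : 'M[R]_(k, m)) (p : 'rV[int]_k) :
  (forall i, G (row i M)) -> G (map_mx intr p *m M).
Proof.
move=> GM; rewrite mulmx_sum_row; elim/big_rec: _ => // i x _ Gx.
by apply: subgroup_add => //; rewrite mxE; exact: subgroup_mulrz.
Qed.

End Subgroup.

Lemma mx_norm_bigmax (R : realType) (m n : nat) (x : 'M[R]_(m, n)) :
  `|x| = \big[Num.max/0]_ij `|x ij.1 ij.2|.
Proof. exact: mx_normrE. Qed.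

Lemma mx_norm_le_sum (R : realType) (m n : nat) (x : 'rV[R]_m) (e : R) (S : 'M[R]_(m, n)) :
  (forall j, `|x 0 j| <= e) -> 0 <= e -> `|x *m S| <= e * \sum_i \sum_j `|S i j|.
Proof.
move=> xe e0; rewrite mx_norm_bigmax.
have S0 : 0 <= \sum_i \sum_j `|S i j| by do 2 apply: sumr_ge0 => ? _.
apply: bigmax_le => [|[i j] _ /=]; first exact: mulr_ge0.
rewrite mxE; apply: le_trans (ler_norm_sum _ _ _) _.
rewrite mulr_sumr; apply: ler_sum => k _; rewrite normrM ord1.
apply: ler_pM => //; rewrite (bigD1 j) //= lerDl.
by apply: sumr_ge0 => ? _.
Qed.

Lemma mx_norm_entry (R : realType) (m n : nat) (x : 'M[R]_(m, n)) i j :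
  `|x i j| <= `|x|.
Proof.
rewrite mx_norm_bigmax.
exact: (le_bigmax _ (fun ij => `|x ij.1 ij.2|) (i, j)).
Qed.

(* A maximal free family M of G spans a lattice of finite index in G (Dirichlet's
   pigeonhole bounds the index), so a multiple of a coordinate form is integral. *)
Lemma discrete_has_integral_functional (R : realType) (m : nat)
    (G : set 'rV[R]_m.+1) (e : R) :
  G 0 -> (forall x y, G x -> G y -> G (x - y)) ->
  0 < e -> (forall g, G g -> `|g| < e -> g = 0) ->
  exists2 phi : 'cV[R]_m.+1, phi != 0 &
    forall g, G g -> (g *m phi) 0 0 \is a Num.int.
Proof.
move=> G0 GB e0 Gdisc.
pose P r := `[< exists M : 'M[R]_(r, m.+1), (forall i, G (row i M)) /\ row_free M >].
have exP : exists r, P r.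
  exists 0; apply/asboolP; exists 0; split; first by case.
  by rewrite /row_free mxrank0.
have leP r : P r -> (r <= m.+1)%N.
  by move=> /asboolP[M [_ /eqP<-]]; exact: rank_leq_col.
case: (ex_maxnP exP leP) => r /asboolP[M [GM Mfree]] rmax.
have Gspan g : G g -> (g <= M)%MS.
  move=> Gg; apply/negPn/negP => gM.
  suff /rmax : P (r + 1)%N by rewrite addn1 ltnn.
  apply/asboolP; exists (col_mx M g); split.
    move=> i; case: (splitP i) => j ij.
      have -> : i = lshift 1 j by apply/val_inj.
      by rewrite rowKu.
    have -> : i = rshift r j by apply/val_inj.
    by rewrite rowKd ord1 row_id.
  rewrite /row_free eqn_leq rank_leq_row /=.
  suff : (\rank M < \rank (col_mx M g))%N.
    by move: (\rank (col_mx _ _)) => k; rewrite (eqP Mfree) addn1.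
  by apply: rank_ltmx; rewrite ltmxE -!addsmxE addsmxSl addsmx_sub submx_refl.
(* If [M] does not have full rank, a nonzero column of its cokernel is a form vanishing on [G]. *)
have [rm|mr] := ltnP r m.+1.
  have [j Mj] : exists j, col j (cokermx M) != 0.
    apply/existsP; rewrite -negb_forall; apply: contraTN rm => /forallP K0.
    rewrite -leqNgt; suff /eqP K : cokermx M = 0.
      by move: K; rewrite -mxrank_eq0 mxrank_coker subn_eq0 (eqP Mfree).
    by apply/matrixP => i j; have /eqP/colP/(_ i) := K0 j; rewrite !mxE.
  exists (col j (cokermx M)) => // g /Gspan; rewrite submxE => /eqP gK.
  by rewrite colE mulmxA gK mul0mx mxE rpred0.
have {leP} rE : r = m.+1 by apply/eqP; rewrite eqn_leq mr -(eqP Mfree) rank_leq_col.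
move: M GM Mfree {rmax mr} Gspan; rewrite {}rE => M GM; rewrite row_free_unit => Mu _.
pose c := \sum_i \sum_j `|M i j|.
have c0 : 0 <= c by do 2 apply: sumr_ge0 => ? _.
(* [K] is so large that combinations of the rows of [M] with coefficients at most [K.+1%:R^-1] are
   shorter than [e]. *)
have [K Ke] : exists K, 0 + K.+1%:R^-1 < e / (c + 1).
  by apply: ltr_add_invr; rewrite divr_gt0 // ltr_wpDl.
rewrite add0r ltr_pdivlMr ?ltr_wpDl // in Ke.
pose N := (K.+1 ^ m.+1)%N.
have MV : M *m invmx M = 1%:M by rewrite mulmxV.
(* The first coordinate with respect to [M], scaled by a factorial that every possible [q <= N]
   divides. *)
exists (N`!%:R *: col 0 (invmx M)).
  rewrite scaler_eq0 negb_or pnatr_eq0 -lt0n fact_gt0 /=.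
  apply/eqP => /(congr1 (mulmx M)); rewrite mulmx0 colE mulmxA MV -colE => /colP/(_ 0).
  by rewrite !mxE eqxx => /eqP; rewrite oner_eq0.
move=> g Gg; have [y yE gE] : exists2 y, g *m invmx M = y & g = y *m M.
  by exists (g *m invmx M); rewrite ?mulmxKV.
have [q [p [q0 qN qp]]] := dirichlet_simultaneous K y.
(* The difference of both sides is the coordinate row of an element of [G] of norm below [e], which
   discreteness makes zero. *)
suff qy : q%:R *: y = map_mx intr p.
  rewrite -scalemxAr colE mulmxA yE -colE !mxE.
  have qN' : (q %| N`!)%N by apply: dvdn_fact; rewrite q0.
  rewrite -(divnK qN') natrM -mulrA.
  have -> : q%:R * y 0 0 = (p 0 0)%:~R by have /rowP/(_ 0) := qy; rewrite !mxE.
  by rewrite rpredM ?natr_int ?intr_int.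
apply/eqP; rewrite -subr_eq0; apply/eqP; apply: (can_inj (mulmxK Mu)).
rewrite mul0mx; apply: Gdisc.
  rewrite mulmxBl -scalemxAl -gE; apply: (GB); last exact: (subgroup_lincomb G0 GB).
  exact: (subgroup_mulrz G0 GB (Posz q)).
apply: le_lt_trans (mx_norm_le_sum (e := K.+1%:R^-1) _ _ _) _ => [j||].
- by rewrite !mxE ltW.
- by rewrite invr_ge0.
- by apply: le_lt_trans Ke; rewrite ler_pM2l ?invr_gt0 // lerDl.
Qed.

(** Take [g k] in [G] nonzero and tending to 0. Their directions have a cluster point [u] on the
    compact unit sphere, and integer multiples of a short [g k] form a fine mesh along a line close
    to that of [u]. *)
Lemma closure_contains_line (R : realType) (m : nat) (G : set 'rV[R]_m) :
  G 0 -> (forall x y, G x -> G y -> G (x - y)) ->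
  (forall e, 0 < e -> exists g, [/\ G g, g != 0 & `|g| < e]) ->
  exists2 u : 'rV[R]_m, u != 0 &
    forall (t e : R), 0 < e -> exists2 g, G g & `|t *: u - g| < e.
Proof.
move=> G0 GB Gsmall.
have /choice[g gP] (k : nat) : exists g, [/\ G g, g != 0 & `|g| < k.+1%:R^-1].
  by apply: Gsmall; rewrite invr_gt0.
pose v k := `|g k|^-1 *: g k.
have gn0 k : 0 < `|g k| by rewrite normr_gt0; have [] := gP k.
have v1 k : `|v k| = 1.
  by rewrite normrZ normfV normr_id mulVf // gt_eqF.
pose S := [set x : 'rV[R]_m | `|x| = 1]%classic.
have Scompact : compact S.
  apply: bounded_closed_compact.
    by exists 1; split=> [|M M1 x /= ->]; [exact: num_real|exact: ltW].
  have -> : S = (Num.norm @^-1` [set 1 : R])%classic by [].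
  apply: closed_comp; last exact: closed_eq.
  by move=> x _; exact: norm_continuous.
have [|u [u1 uclus]] := Scompact (v @ \oo)%classic _.
  by exists 0 => // k _; exact: v1.
exists u; first by rewrite -normr_gt0 u1.
move=> t e e0.
have d0 : 0 < e / 2 / (`|t| + 1) by rewrite !divr_gt0 // ltr_wpDl.
have [N Ne] : exists N, 0 + N.+1%:R^-1 < e / 2 by apply: ltr_add_invr; rewrite divr_gt0.
have [_ [[k /= Nk <-] uk]] :
    (v @` [set k | (N <= k)%N] `&` ball u (e / 2 / (`|t| + 1)) !=set0)%classic.
  apply: uclus; last exact: nbhsx_ballx.
  by exists N => // k /= Nk; exists k.
rewrite mx_norm_ball /ball_ /= in uk.
pose j := Num.floor (t / `|g k|).
exists (j%:~R *: g k); first by apply: subgroup_mulrz => //; have [] := gP k.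
have gE : g k = `|g k| *: v k by rewrite /v scalerA mulfV ?scale1r // gt_eqF.
(* The error splits into the angular part [t *: (u - w)] and a rounding part of norm at most
   [|g k|]. *)
have := v1 k; move: (v k) uk gE => w uw gE w1.
have -> : t *: u - j%:~R *: g k = t *: (u - w) + (t - j%:~R * `|g k|) *: w.
  by rewrite {1}gE scalerBr scalerBl scalerA addrA subrK.
apply: le_lt_trans (ler_normD _ _) _; rewrite !normrZ w1 mulr1 (splitr e).
apply: ler_ltD.
  apply: (le_trans (ler_wpM2l (normr_ge0 _) (ltW uw))).
  rewrite mulrCA ler_piMr ?divr_ge0 ?(ltW e0) //.
  by rewrite ler_pdivrMr ?mul1r ?lerDl // ltr_wpDl.
have : `|g k| < e / 2.
  have [_ _ gk] := gP k; apply: lt_le_trans gk _; apply: le_trans (ltW Ne).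
  by rewrite add0r lef_pV2 ?posrE ?ltr0n // ler_nat ltnS.
apply: le_lt_trans; have /andP[] := floor_itv (t / `|g k|).
rewrite -/j ler_pdivlMr // ltr_pdivrMr // intrD => j1 j2.
by rewrite ger0_norm ?subr_ge0 // lerBlDr; lra.
Qed.

(* Induction on m: G is not discrete, so its closure contains a line R u; project
   along u. *)
Lemma dense_of_no_integral_functional (R : realType) (m : nat) (G : set 'rV[R]_m) :
  G 0 -> (forall x y, G x -> G y -> G (x - y)) ->
  (forall phi : 'cV[R]_m,
    (forall g, G g -> (g *m phi) 0 0 \is a Num.int) -> phi = 0) ->
  forall (x : 'rV[R]_m) (e : R), 0 < e -> exists2 g, G g & `|x - g| < e.
Proof.
elim: m G => [|m IH] G G0 GB Gfun x e e0.
  by exists 0 => //; rewrite [x - 0]thinmx0 normr0.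
have [u u0 Gu] : exists2 u : 'rV[R]_m.+1, u != 0 &
    forall (t e : R), 0 < e -> exists2 g, G g & `|t *: u - g| < e.
  apply: closure_contains_line => // d d0; apply/not_existsP => Gdisc.
  have [|phi phi0 /Gfun phiE] := discrete_has_integral_functional G0 GB d0.
    by move=> g Gg gd; apply/eqP/negPn/negP => g0; apply: (Gdisc g).
  by rewrite phiE eqxx in phi0.
have [i ui] : exists i, u 0 i != 0.
  by apply/rV0Pn.
(* [P] projects along [u] and drops coordinate [i]; [S] reinserts a zero there. *)
pose P : 'M[R]_(m.+1, m) :=
  \matrix_(a, b) ((a == lift i b)%:R - (a == i)%:R * (u 0 (lift i b) / u 0 i)).
pose S : 'M[R]_(m, m.+1) := \matrix_(a, b) (lift i a == b)%:R.
have SP : S *m P = 1%:M.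
  apply/matrixP => a b; rewrite mxE (bigD1 (lift i a)) //= big1 => [|k ki].
    rewrite !mxE eqxx mul1r (inj_eq lift_inj) [lift i a == i]eq_sym.
    by rewrite (negPf (neq_lift _ _)) mul0r subr0 addr0.
  by rewrite !mxE eq_sym (negPf ki) mul0r.
have PS (y : 'rV[R]_m.+1) : y - y *m P *m S = (y 0 i / u 0 i) *: u.
  have yP b : (y *m P) 0 b = y 0 (lift i b) - y 0 i * (u 0 (lift i b) / u 0 i).
    have il : (lift i b == i) = false by rewrite eq_sym (negPf (neq_lift _ _)).
    rewrite mxE (bigD1 i) //= (bigD1 (lift i b)) /= ?il //.
    rewrite big1 => [|k /andP[ki kb]].
      by rewrite ![P _ _]mxE !eqxx [i == lift i b]eq_sym il /=; ring.
    by rewrite [P _ _]mxE (negPf kb) (negPf ki) mul0r subr0 mulr0.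
  apply/rowP => k; rewrite [LHS]mxE [X in _ + X]mxE [(y *m P *m S) _ _]mxE [RHS]mxE.
  case: (unliftP i k) => [b ->|->].
    rewrite (bigD1 b) //= big1 => [|b' bb'].
      by rewrite yP [S _ _]mxE eqxx mulr1 addr0; ring.
    by rewrite [S _ _]mxE (inj_eq lift_inj) (negPf bb') mulr0.
  rewrite big1 => [|b' _]; first by rewrite subr0 divfK.
  by rewrite [S _ _]mxE eq_sym (negPf (neq_lift _ _)) mulr0.
pose c := \sum_i \sum_j `|S i j|.
have c0 : 0 <= c by do 2 apply: sumr_ge0 => ? _.
pose e' := e / 2 / (c + 1).
have e'0 : 0 < e' by rewrite !divr_gt0 // ltr_wpDl.
pose G' := [set g *m P | g in G]%classic.
have G'0 : G' 0 by exists 0; rewrite ?mul0mx.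
have G'B x1 x2 : G' x1 -> G' x2 -> G' (x1 - x2).
  by move=> [y Gy <-] [z Gz <-]; exists (y - z); [exact: GB|rewrite mulmxBl].
(* A form [phi] integral on [G'] pulls back to [P *m phi], integral on [G]. *)
have G'fun (phi : 'cV[R]_m) :
    (forall g, G' g -> (g *m phi) 0 0 \is a Num.int) -> phi = 0.
  move=> phiint; rewrite -[phi]mul1mx -SP -mulmxA (Gfun (P *m phi)) ?mulmx0 // => g Gg.
  by rewrite mulmxA; apply: phiint; exists g.
have [_ [g Gg <-] gx] := IH G' G'0 G'B G'fun (x *m P) e' e'0.
(* [h] corrects the component along [u] that the projection does not see. *)
have [h Gh hx] := Gu ((x - g) 0 i / u 0 i) (e / 2) (divr_gt0 e0 (ltr0Sn _ _)).
exists (g + h); first by apply: subgroup_add.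
have -> : x - (g + h) = (x *m P - g *m P) *m S + (((x - g) 0 i / u 0 i) *: u - h).
  rewrite -PS -(mulmxBl x g P); move: (_ *m S) => z.
  by rewrite [RHS]addrA [z + _]addrC subrK opprD addrA.
apply: le_lt_trans (ler_normD _ _) _; rewrite [ltRHS]splitr; apply: ler_ltD => //.
apply: le_trans (mx_norm_le_sum (e := e') _ _ (ltW e'0)) _.
- by move=> j; apply: ltW; apply: le_lt_trans gx; exact: mx_norm_entry.
- by rewrite /e' -mulrA ler_piMr ?divr_ge0 ?(ltW e0) // ler_pdivrMl ?ltr_wpDl // mulr1 lerDl.
Qed.

(** * Generic points *)

(** Nonzero polynomials have finitely many roots, so the excluded [t] form a countable, hence
    Lebesgue-null, set, which cannot contain [0, 1]. *)
Lemma exists_common_nonroot (R : realType) (I : countType) (p : I -> {poly R}) :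
  exists t : R, forall i, p i != 0 -> (p i).[t] != 0.
Proof.
pose bad i := [set t : R | p i != 0 /\ root (p i) t]%classic.
have bad_countable : countable (\bigcup_(i in setT) bad i)%classic.
  apply: bigcup_countable; first exact: countableP.
  move=> i _; apply: finite_set_countable.
  apply: contrapT => /(infinite_set_fset (size (p i)).+1)[B Bbad pB].
  move: pB (finmap.fset_uniq B) (Bbad : forall y, y \in finmap.enum_fset B -> bad i y).
  case: (finmap.enum_fset B) => // x s ps us sbad.
  have [pi _] := sbad x (mem_head _ _).
  have : (size (x :: s) < size (p i))%N.
    by apply: max_poly_roots => //; apply/allP => y /sbad[].
  by rewrite ltnNge (leq_trans _ ps).
apply: contrapT => /forallNP nt.
have : lebesgue_measure (`[0, 1]%classic : set R) = 0%E.
  apply: countable_lebesgue_measure0; apply: sub_countable bad_countable.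
  apply: subset_card_le => t _; have /existsNP[i /not_implyP[pi /negP]] := nt t.
  by rewrite negbK => it; exists i.
by rewrite lebesgue_measure_itv /= lte_fin ltr01 sube0 => -[/eqP]; rewrite oner_eq0.
Qed.

(** On the moment curve (1, t, t^2, ...) a nonzero linear form becomes a nonzero polynomial in t. *)
Lemma exists_generic_vector (R : realType) (I : countType) (N : nat) (c : I -> 'rV[R]_N) :
  exists u : 'rV[R]_N, forall i, c i != 0 -> \sum_k c i 0 k * u 0 k != 0.
Proof.
have [t tP] := exists_common_nonroot (fun i => rVpoly (c i)).
exists (\row_k t ^+ k) => i ci.
have /tP : rVpoly (c i) != 0 by apply: contraNneq ci => c0; rewrite -[c i]rVpolyK c0 linear0.
rewrite (horner_coef_wide _ (size_poly _ _)); congr (_ != 0); apply: eq_bigr => k _.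
by rewrite coef_rVpoly_ord mxE.
Qed.

(** Move from [V0] along [V0 + t *: U], where [U] pairs nontrivially with each nonzero [c i]. Every
    condition is then a nonzero polynomial in t: the determinant by its value at 0, a pairing by its
    coefficient of t. *)
Lemma exists_generic_matrix (R : realType) (I : countType) (p q n : nat)
    (c : I -> 'M[R]_(p, q)) (Phi : 'M[R]_(p, q) -> 'M[R]_n) (V0 : 'M[R]_(p, q)) :
  linear Phi -> Phi V0 \in unitmx ->
  exists2 V : 'M[R]_(p, q), Phi V \in unitmx &
    forall i, c i != 0 -> \sum_a \sum_b c i a b * V a b != 0.
Proof.
move=> Phi_lin V0u.
pose pairing (X Y : 'M[R]_(p, q)) := \sum_a \sum_b X a b * Y a b.
have [u uP] := exists_generic_vector (fun i => mxvec (c i)).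
pose U : 'M[R]_(p, q) := vec_mx u.
have UP i : c i != 0 -> pairing (c i) U != 0.
  move=> ci; have /uP : mxvec (c i) != 0 by rewrite mxvec_eq0.
  rewrite /pairing pair_bigA (reindex _ (curry_mxvec_bij p q)) /=.
  by congr (_ != 0); apply: eq_bigr => -[a b] _; rewrite mxvecE mxE.
pose detp : {poly R} := \det (map_mx polyC (Phi V0) + 'X *: map_mx polyC (Phi U)).
pose fam (i : I + unit) : {poly R} :=
  match i with
  | inl i => (pairing (c i) V0)%:P + pairing (c i) U *: 'X
  | inr _ => detp
  end.
have detpE t : detp.[t] = \det (Phi (V0 + t *: U)).
  rewrite -horner_evalE -det_map_mx; congr (\det _); apply/matrixP => a b.
  by rewrite [V0 + _]addrC Phi_lin !mxE /= horner_evalE !hornerE addrC.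
have [t tP] := exists_common_nonroot fam.
exists (V0 + t *: U) => [|i ci].
  rewrite unitmxE unitfE -detpE; apply: (tP (inr tt)).
  apply: contraTneq V0u => d0; rewrite unitmxE unitfE negbK.
  by rewrite -[V0]addr0 -(scale0r U) -detpE -[detp]/(fam (inr tt)) d0 horner0.
have /tP : fam (inl i) != 0.
  apply: contraNneq (UP i ci) => /polyP/(_ 1%N).
  by rewrite coefD coefC coefZ coefX /= add0r mulr1 coef0 => ->.
rewrite /= !hornerE; congr (_ != 0); rewrite /pairing mulr_suml -big_split /=.
apply: eq_bigr => a _; rewrite mulr_suml -big_split /=; apply: eq_bigr => b _.
by rewrite !mxE; ring.
Qed.

(** * The integral minimal polynomial *)

Lemma diagonalizable_mxminpoly (F : fieldType) (n : nat) (A : 'M[F]_n.+1) :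
  diagonalizable A ->
  exists rs : seq F, [/\ uniq rs, forall z, eigenvalue A z = (z \in rs) &
    mxminpoly A = \prod_(r <- rs) ('X - r%:P)].
Proof.
move=> [P Pu PA]; have := diagonalizable_for_mxminpoly Pu PA.
set rs := undup _ => Emin; exists rs; split=> //; first exact: undup_uniq.
by move=> z; rewrite eigenvalue_root_min Emin root_prod_XsubC.
Qed.

(** The minimal polynomial has simple roots, so being divisible by it only requires vanishing at
    them. *)
Lemma diagonalizable_horner_eq0 (F : fieldType) (n : nat) (A : 'M[F]_n.+1)
    (p : {poly F}) :
  diagonalizable A ->
  (horner_mx A p = 0 <-> forall z, eigenvalue A z -> root p z).
Proof.
move=> /diagonalizable_mxminpoly[rs [rs_uniq Eroot Emin]].
split=> [/mxminpoly_min pA z|proot].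
  by rewrite Eroot => zrs; apply: (root_dvdp pA); rewrite Emin root_prod_XsubC.
apply/mxminpoly_minP; rewrite Emin; apply: uniq_roots_dvdp.
  by apply/allP => z zrs; apply: proot; rewrite Eroot.
by rewrite uniq_rootsE.
Qed.

Lemma map_poly_ratr_int (F : numFieldType) (p : {poly int}) :
  map_poly ratr (map_poly intr p : {poly rat}) = map_poly intr p :> {poly F}.
Proof. by rewrite -map_poly_comp; apply: eq_map_poly => x; rewrite /= ratr_int. Qed.

Lemma algebraic_integers_common_poly (F : fieldType) (rs : seq F) :
  {in rs, forall z, algebraic_integer z} ->
  exists2 f : {poly int}, f \is monic & {in rs, forall z, root (map_poly intr f) z}.
Proof.
elim: rs => [|z rs IH] Hrs; first by exists 1; rewrite ?monic1.
have [|f fm froot] := IH; first by move=> x xrs; apply: Hrs; rewrite inE xrs orbT.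
have [g [gm groot]] := Hrs z (mem_head _ _).
exists (g * f) => [|x]; first by rewrite rpredM.
rewrite inE rmorphM rootM => /orP[/eqP->|/froot->]; rewrite ?orbT //.
by rewrite groot.
Qed.

Lemma horner_mx_cplx (R : realType) (n : nat) (A : 'M[R]_n.+1) (p : {poly rat}) :
  horner_mx A (map_poly ratr p) = 0 <->
  horner_mx (cplx_mx A) (map_poly ratr p) = 0.
Proof.
have E : horner_mx (cplx_mx A) (map_poly ratr p) =
         cplx_mx (horner_mx A (map_poly ratr p)).
  rewrite /cplx_mx map_horner_mx -map_poly_comp; congr horner_mx.
  by apply: eq_map_poly => x; rewrite /= fmorph_rat.
rewrite E; split=> [->|/eqP]; first by rewrite /cplx_mx map_mx0.
by rewrite /cplx_mx map_mx_eq0 => /eqP.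
Qed.

(** A rational annihilator of least degree divides a monic integer one, so Gauss's lemma makes it
    integral. Invertibility of f'(A) expresses separability. *)
Lemma integral_minimal_poly (R : realType) (n : nat) (A : 'M[R]_n.+1) :
  diagonalizable (cplx_mx A) ->
  (forall z : R[i], eigenvalue (cplx_mx A) z -> algebraic_integer z) ->
  exists f : {poly int},
    [/\ f \is monic,
        horner_mx A (map_poly intr f) = 0,
        forall g : {poly int}, (size g < size f)%N ->
          horner_mx A (map_poly intr g) = 0 -> g = 0 &
        horner_mx A (map_poly intr f^`()) \in unitmx].
Proof.
move=> Adiag Aint.
pose ann (p : {poly rat}) := horner_mx A (map_poly ratr p) = 0.
have annE p : ann p <->
    forall z : R[i], eigenvalue (cplx_mx A) z -> root (map_poly ratr p) z.
  by rewrite /ann horner_mx_cplx diagonalizable_horner_eq0.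
have [f0 f0m f0ann] : exists2 f0 : {poly int}, f0 \is monic & ann (map_poly intr f0).
  have [rs [_ Eroot _]] := diagonalizable_mxminpoly Adiag.
  have [|f0 f0m f0root] := @algebraic_integers_common_poly _ rs.
    by move=> z; rewrite -Eroot => /Aint.
  exists f0 => //; apply/annE => z; rewrite Eroot map_poly_ratr_int; exact: f0root.
have ZtoQ0 (p : {poly int}) : (map_poly intr p == 0 :> {poly rat}) = (p == 0).
  by rewrite -!lead_coef_eq0 (lead_coef_map_inj (@intr_inj rat)) ?intr_eq0.

have exP : exists k, `[< exists p : {poly rat}, [/\ p != 0, ann p & size p = k] >].
  exists (size f0); apply/asboolP; exists (map_poly intr f0); split => //.
    by rewrite ZtoQ0 monic_neq0.
  by rewrite size_map_inj_poly //; exact: intr_inj.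
case: (ex_minnP exP) => k /asboolP[p [p0 pann ps]] kmin.
have pmin (q : {poly rat}) : (size q < k)%N -> ann q -> q = 0.
  move=> qk qann; apply/eqP; apply/negPn/negP => q0.
  suff kq : (k <= size q)%N by move: qk; rewrite ltnNge kq.
  by apply: kmin; apply/asboolP; exists q.
have annM q1 q2 : ann q1 -> ann (q1 * q2).
  by rewrite /ann !rmorphM /= => ->; rewrite mul0r.
have pdvd (q : {poly rat}) : ann q -> p %| q.
  move=> qann; rewrite /dvdp; apply/eqP; apply: pmin; first by rewrite -ps ltn_modp.
  have E : horner_mx A (map_poly ratr q) = horner_mx A (map_poly ratr (q %/ p * p)) +
      horner_mx A (map_poly ratr (q %% p)) by rewrite -!rmorphD /= -divp_eq.
  by move: E; rewrite qann mulrC (annM _ _ pann) add0r.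
(* Gauss's lemma: [p1] is an integer multiple-up-to-scalar of [p] dividing [f0] in Z[x]. As [f0] is
   monic, the leading coefficients of [p1] and [r] are mutually inverse integers. *)
have [p1 [a a0 pE] [r f0E]] := dvdpP_rat_int (pdvd _ f0ann).
have lr : lead_coef p1 * lead_coef r = 1 by rewrite -lead_coefM -f0E; apply/eqP.
have p1ann : ann (map_poly intr p1).
  have -> : map_poly intr p1 = p * (a^-1)%:P.
    by rewrite mulrC mul_polyC pE scalerA mulVf // scale1r.
  exact: annM.
pose f := lead_coef r *: p1.
have r0 : lead_coef r != 0 by apply: contra_eq_neq lr => ->; rewrite mulr0 eq_sym oner_neq0.
have fE : map_poly intr f = (lead_coef r)%:~R *: map_poly intr p1 :> {poly rat}.
  by rewrite /f -mul_polyC rmorphM /= map_polyC /= mul_polyC.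
have fann : ann (map_poly intr f) by rewrite fE -mul_polyC mulrC; exact: annM.
have fs : size f = k.
  by rewrite /f size_scale // -ps pE size_scale // size_map_inj_poly //; exact: intr_inj.
have fm : f \is monic by rewrite monicE /f lead_coefZ mulrC lr.
have szZ (g : {poly int}) : size (map_poly intr g : {poly rat}) = size g.
  by rewrite size_map_inj_poly //; exact: intr_inj.
have annZ (g : {poly int}) : ann (map_poly intr g) <-> horner_mx A (map_poly intr g) = 0.
  by rewrite /ann map_poly_ratr_int.
exists f; split => //; first exact/annZ.
  by move=> g; rewrite fs -szZ => gk /annZ /pmin -/(_ gk) /eqP; rewrite ZtoQ0 => /eqP.
pose F : {poly rat} := map_poly intr f.
have F0 : F != 0 by rewrite ZtoQ0 monic_neq0.
have : separable_poly F.
  apply/separable_polyP; split=> [|u uF us]; last first.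
    rewrite -size_poly_eq0 polyorder.size_deriv; by case: (size u) us => [|[]].
  (* If [F = v * u ^+ 2], then [u * v] has the same roots as [F], so it also annihilates [A], in
     smaller degree. *)
  apply/poly_square_freeP => u us; apply/negP => /dvdpP[v Fv].
  have uv0 : u * v != 0.
    by apply: contraNneq F0 => uv; rewrite Fv mulrC expr2 -mulrA uv mulr0.
  have [u0 v0] : u != 0 /\ v != 0 by move: uv0; rewrite mulf_eq0 negb_or => /andP.
  have /pmin : ann (u * v).
    apply/annE => z zA; have := proj1 (annE _) fann z zA.
    by rewrite -/F Fv !rmorphM /= !rootM => /or3P[] ->; rewrite ?orbT.
  move=> uv_eq0; move: uv0; rewrite uv_eq0 ?eqxx // -fs -szZ -/F.
  rewrite Fv expr2 mulrA (mulrC v) [ltnRHS]size_mul ?mulf_neq0 //.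
  move: (u0) us (size_poly_gt0 (u * v)); rewrite -size_poly_gt0 mulf_neq0 //.
  move: (size u) (size (u * v)) => a1 b1; case: a1 => [|[|a1]] //.
  by case: b1 => // b1 _ _ _; rewrite !(addSn, addnS) /= !ltnS leq_addr.
(* Evaluating a Bezout relation between [F] and its derivative at [A] exhibits an inverse of
   f'(A). *)
rewrite unlock => /Bezout_eq1_coprimepP[[u v] /= uv1].
have := congr1 (fun q => horner_mx A (map_poly ratr q)) uv1.
rewrite rmorphD !rmorphM rmorphD /= !(rmorphM (horner_mx A)) /=.
rewrite (fann : horner_mx A (map_poly ratr F) = 0) mulr0 add0r !rmorph1 => vE.
have [_] := mulmx1_unit vE.
by rewrite /F deriv_map map_poly_ratr_int.
Qed.

(** * Schemes from intertwiners *)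

(** The rows of [sg] are completed to a basis by those of [T]; the inverse basis matrix supplies
    [Q], whose columns span the right kernel of [sg]. *)
Lemma row_free_split (F : fieldType) (n m : nat) (sg : 'M[F]_(n, n + m)) :
  row_free sg ->
  exists (Q : 'M[F]_(n + m, m)) (T : 'M[F]_(m, n + m)) (X : 'M[F]_(n + m, n)),
    [/\ sg *m Q = 0, T *m Q = 1%:M & X *m sg + Q *m T = 1%:M].
Proof.
move=> /eqP rk; have := mulmx_ebase sg; rewrite rk pid_mx_row.
set c := col_ebase sg; set W := row_ebase sg => sgE.
have Wu : W \in unitmx by exact: row_ebase_unit.
have cu : c \in unitmx by exact: col_ebase_unit.
have [V WV VW] : exists2 V, W *m V = 1%:M & V *m W = 1%:M.
  by exists (invmx W); rewrite ?mulmxV ?mulVmx.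
exists (rsubmx V), (dsubmx W), (lsubmx V *m invmx c).
rewrite -[W]vsubmxK -[V]hsubmxK mul_col_row scalar_mx_block in WV.
have [WV1 WV2 _ WV4] := eq_block_mx WV.
rewrite -[W]vsubmxK -[V]hsubmxK mul_row_col in VW.
have {}sgE : sg = c *m usubmx W.
  by rewrite -sgE -[W in LHS]vsubmxK -mulmxA mul_row_col mul1mx mul0mx addr0.
split=> //; first by rewrite sgE -mulmxA WV2 mulmx0.
by rewrite sgE mulmxA mulmxKV.
Qed.

(* Row-vector convention: L^T = [pi | Q]. *)
Lemma scheme_of_intertwiners (R : realType) (n m : nat) (A : 'M[R]_n)
    (C : 'M[int]_(n + m)) (pi : 'M[R]_(n + m, n)) (sg : 'M[R]_(n, n + m)) :
  map_mx intr C *m pi = pi *m A^T ->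
  sg *m map_mx intr C = A^T *m sg ->
  sg *m pi \in unitmx ->
  (forall r : 'rV[int]_(n + m), map_mx intr r *m pi = 0 -> r = 0) ->
  (forall (r : 'rV[int]_(n + m)) (w : 'rV[R]_n), map_mx intr r = w *m sg -> r = 0) ->
  (forall u : 'cV[int]_(n + m), sg *m map_mx intr u = 0 -> u = 0) ->
  exists L : 'M[R]_(n + m), [/\ nonsingular L, generic_cps L & self_similarity L A].
Proof.
move=> piC sgC sgpi pi_inj sg_im sg_int.
have sg_free : row_free sg.
  rewrite -row_leq_rank; apply: leq_trans (mxrankM_maxl sg pi).
  by rewrite row_leq_rank row_free_unit.
have [Q [T [X [sgQ TQ XQ]]]] := row_free_split sg_free.
pose M := row_mx pi Q.
have L_par (r : 'cV[int]_(n + m)) : pi_par (lpt M^T r) = pi^T *m map_mx intr r.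
  by rewrite /pi_par /lpt tr_row_mx mul_col_mx col_mxKu.
have L_perp (r : 'cV[int]_(n + m)) : pi_perp (lpt M^T r) = Q^T *m map_mx intr r.
  by rewrite /pi_perp /lpt tr_row_mx mul_col_mx col_mxKd.
(* [C] preserves the kernel of [sg], and [T] reads off its matrix there, the transpose of [B]. *)
have CQ : map_mx intr C *m Q = Q *m (T *m map_mx intr C *m Q).
  rewrite -[LHS]mul1mx -XQ mulmxDl -!mulmxA (mulmxA sg) sgC -!mulmxA sgQ.
  by rewrite !mulmx0 add0r.
have LC : block_mx A 0 0 (T *m map_mx intr C *m Q)^T *m M^T = M^T *m map_mx intr C^T.
  rewrite -[A in LHS]trmxK -[0 in X in block_mx _ X](trmx0 R) -[0 in X in block_mx _ _ X](trmx0 R).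
  rewrite -tr_block_mx -trmx_mul -map_trmx -trmx_mul; congr (_^T).
  by rewrite /M mul_row_block mulmx0 addr0 mulmx0 add0r mul_mx_row piC -CQ.
exists M^T; split.
- rewrite /nonsingular det_tr; apply: contraTneq sgpi => M0.
  (* This product is block lower triangular with diagonal blocks [sg *m pi] and 1. *)
  have : \det (col_mx sg T *m M) = 0 by rewrite det_mulmx M0 mulr0.
  rewrite mul_col_row sgQ TQ det_lblock det1 mulr1 => d0.
  by rewrite unitmxE unitfE d0 eqxx.
- split.
  + move=> r1 r2; rewrite !L_par => E; suff -> : r1 = r2 by [].
    apply/eqP; rewrite -subr_eq0 -[_ - _]trmxK trmx_eq0; apply/eqP/pi_inj.
    by rewrite -map_trmx -[pi]trmxK -trmx_mul map_mxB mulmxBr E subrr trmx0.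
  + move=> r1 r2; rewrite !L_perp => E; suff -> : r1 = r2 by [].
    apply/eqP; rewrite -subr_eq0 -[_ - _]trmxK trmx_eq0; apply/eqP.
    pose r := map_mx intr (r1 - r2)^T : 'rV[R]_(n + m).
    have rQ : r *m Q = 0.
      by rewrite /r -map_trmx -[Q]trmxK -trmx_mul map_mxB mulmxBr E subrr trmx0.
    (* As [r *m Q = 0], the splitting of the identity puts [r] in the row space of [sg]. *)
    apply: (sg_im _ (r *m X)); rewrite -/r -{1}[r]mulmx1 -XQ mulmxDr !mulmxA.
    by rewrite rQ mul0mx addr0.
  + move=> O [x Ox] Oopen.
    have /nbhs_ballP[e /= e0 xe] : nbhs x O by exact: open_nbhs_nbhs.
    pose G := [set map_mx intr r *m Q | r in [set: 'rV[int]_(n + m)]]%classic.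
    have G0 : G 0 by exists 0; rewrite // map_mx0 mul0mx.
    have GB y z : G y -> G z -> G (y - z).
      by move=> [r _ <-] [r' _ <-]; exists (r - r'); rewrite // map_mxB mulmxBl.
    have Gfun (phi : 'cV[R]_m) :
        (forall g, G g -> (g *m phi) 0 0 \is a Num.int) -> phi = 0.
      (* Integrality of [phi] on the generators of [G] says that [Q *m phi] is an integer vector; it
         is killed by [sg], hence zero. *)
      move=> phiint; pose u := map_mx Num.floor (Q *m phi).
      have uE : Q *m phi = map_mx intr u.
        apply/colP => i; rewrite [RHS]mxE [u _ _]mxE floorK //.
        have /phiint : G (map_mx intr (delta_mx 0 i) *m Q) by exists (delta_mx 0 i).
        by rewrite map_delta_mx -mulmxA -rowE mxE.
      rewrite -[phi]mul1mx -TQ -mulmxA uE (sg_int u) ?map_mx0 ?mulmx0 //.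
      by rewrite -uE mulmxA sgQ mul0mx.
    have [_ [r _ <-] rx] := dense_of_no_integral_functional G0 GB Gfun x^T e0.
    exists (Q^T *m map_mx intr r^T); split; last first.
      by exists r^T => //; rewrite L_perp.
    apply: xe; split=> // i j; apply: le_lt_trans rx.
    have := mx_norm_entry (x^T - map_mx intr r *m Q) j i.
    by rewrite -map_trmx -trmx_mul !mxE.
- split; last by exists C^T, (T *m map_mx intr C *m Q)^T.
  move=> r; exists (C^T *m r); rewrite !L_par map_mxM !mulmxA.
  by rewrite -map_trmx -trmx_mul piC trmx_mul trmxK.
Qed.

(** * Intertwiners of the companion matrix *)

Notation ipoly D p := (horner_mx D (map_poly intr p)).

(** In the basis of powers of x, the matrix of the map g |-> v g(D) on polynomials of degree below
    [d]. *)
Definition krylov_mx (R : realType) (n d : nat) (D : 'M[R]_n.+1) (v : 'rV[R]_n.+1) :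
  'M[R]_(d, n.+1) := \matrix_(a < d) (v *m D ^+ a).

(* The polynomials drop_poly b.+1 f are, up to the factor f', the basis dual to
   (x^b) for the trace form of Q[x]/f (Euler); this makes the matrix below
   intertwine D with the companion matrix. *)
Definition dual_krylov_mx (R : realType) (n : nat) (f : {poly int}) (D : 'M[R]_n.+1)
    (psi : 'cV[R]_n.+1) : 'M[R]_(n.+1, (size f).-1) :=
  \matrix_(i, b) (ipoly D (drop_poly b.+1 f) *m psi) i 0.

Lemma col_dual_krylov_mx (R : realType) (n : nat) (f : {poly int}) (D : 'M[R]_n.+1)
    (psi : 'cV[R]_n.+1) b :
  col b (dual_krylov_mx f D psi) = ipoly D (drop_poly b.+1 f) *m psi.
Proof. by apply/colP => i; rewrite !mxE. Qed.

Lemma ipolyE (R : realType) (n d : nat) (D : 'M[R]_n.+1) (p : {poly int}) :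
  (size p <= d)%N -> ipoly D p = \sum_(a < d) (p`_a)%:~R *: D ^+ a.
Proof.
move=> pd; have -> : map_poly intr p = \poly_(a < d) (p`_a)%:~R :> {poly R}.
  apply/polyP => i; rewrite coef_map coef_poly /=.
  by case: ltnP => // di; rewrite nth_default // (leq_trans pd).
rewrite poly_def linear_sum; apply: eq_bigr => a _.
by rewrite linearZ /= rmorphXn /= horner_mx_X.
Qed.

Lemma ipolyZ (R : realType) (n : nat) (D : 'M[R]_n.+1) (c : int) (p : {poly int}) :
  ipoly D (c *: p) = c%:~R *: ipoly D p.
Proof.
rewrite -mul_polyC !rmorphM /= map_polyC /= horner_mx_C; exact: mul_scalar_mx.
Qed.

Lemma mul_rV_krylov (R : realType) (n d : nat) (D : 'M[R]_n.+1) (v : 'rV[R]_n.+1)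
    (r : 'rV[int]_d) :
  map_mx intr r *m krylov_mx d D v = v *m ipoly D (rVpoly r).
Proof.
rewrite (ipolyE _ (size_poly _ _)) mulmx_sumr mulmx_sum_row; apply: eq_bigr => a _.
by rewrite rowK mxE coef_rVpoly_ord scalemxAr.
Qed.

(** Multiplication by x shifts the rows of the Krylov matrix; the last row wraps around through f(D)
    = 0. *)
Lemma companion_krylov (R : realType) (n : nat) (f : {poly int}) (D : 'M[R]_n.+1)
    (v : 'rV[R]_n.+1) :
  f \is monic -> ipoly D f = 0 ->
  map_mx intr (companionmx f) *m krylov_mx _ D v = krylov_mx (size f).-1 D v *m D.
Proof.
move=> fm fD; have f0 : (0 < size f)%N by rewrite size_poly_gt0 monic_neq0.
have sf : size f = (size f).-1.+1 by rewrite prednK.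
apply/row_matrixP => a; rewrite !row_mul rowK -mulmxA.
rewrite (_ : D ^+ a *m D = D ^+ a.+1); last by rewrite exprSr.
rewrite mulmx_sum_row; under eq_bigr do rewrite rowK !mxE.
have [ad|ad] := eqVneq (a : nat) (size f).-2.
  have fD' : \sum_(b < (size f).-1) (f`_b)%:~R *: D ^+ b = - D ^+ (size f).-1.
    have : (size f <= (size f).-1.+1)%N by rewrite prednK.
    move/(ipolyE D); rewrite fD big_ord_recr /= -/(lead_coef f) (monicP fm) scale1r.
    by move/esym/eqP; rewrite addr_eq0 => /eqP.
  under eq_bigr do rewrite intrN scaleNr scalemxAr.
  rewrite sumrN -mulmx_sumr fD' mulmxN opprK ad prednK //.
  exact: leq_ltn_trans (leq0n _) (ltn_ord a).
have a1 : (a.+1 < (size f).-1)%N.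
  have := ltn_ord a; rewrite leq_eqVlt => /predU1P[E|//].
  by case/eqP: ad; move/(congr1 predn): E.
rewrite (bigD1 (Ordinal a1)) //= big1 => [|b ba]; first by rewrite eqxx scale1r addr0.
rewrite (_ : a.+1 == b = false) ?scale0r //; apply: contraNF ba => /eqP E.
exact/eqP/val_inj.
Qed.

Lemma drop_polyS (p : {poly int}) (b : nat) :
  drop_poly b p = 'X * drop_poly b.+1 p + (p`_b)%:P.
Proof.
apply/polyP => i; rewrite coefD coefXM coefC !coef_drop_poly.
by case: i => [|i] /=; rewrite ?add0r // addr0 addnS addSn.
Qed.

Lemma drop_poly_monic (p : {poly int}) : p \is monic -> drop_poly (size p).-1 p = 1.
Proof.
move=> pm; have p0 : (0 < size p)%N by rewrite size_poly_gt0 monic_neq0.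
apply/polyP => k; rewrite coef_drop_poly coef1.
case: k => [|k]; first by rewrite add0n -/(lead_coef p) (monicP pm).
by rewrite nth_default // addSn -addnS prednK // leq_addl.
Qed.

Lemma dual_krylov_companion (R : realType) (n : nat) (f : {poly int}) (D : 'M[R]_n.+1)
    (psi : 'cV[R]_n.+1) :
  f \is monic -> ipoly D f = 0 ->
  dual_krylov_mx f D psi *m map_mx intr (companionmx f) = D *m dual_krylov_mx f D psi.
Proof.
move=> fm fD; have f0 : (0 < size f)%N by rewrite size_poly_gt0 monic_neq0.
apply/matrixP => i b.
have d1 : (0 < (size f).-1)%N by exact: leq_ltn_trans (leq0n _) (ltn_ord b).
have d0 : ((size f).-2 < (size f).-1)%N by rewrite ltn_predL.
have E : (dual_krylov_mx f D psi *m map_mx intr (companionmx f)) i b =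
    (ipoly D (drop_poly b f) *m psi) i 0 - (f`_b)%:~R * psi i 0.
  have SE a : dual_krylov_mx f D psi i a = (ipoly D (drop_poly a.+1 f) *m psi) i 0.
    by rewrite mxE.
  rewrite mxE (bigD1 (Ordinal d0)) //= SE [map_mx _ _ _ _]mxE [companionmx _ _ _]mxE /= eqxx.
  rewrite (prednK d1) drop_poly_monic //.
  rewrite !rmorph1 [1 *m psi]mul1mx intrN mulrN mulrC addrC; congr (_ - _).
  have Ka (a : 'I_(size f).-1) : a != Ordinal d0 ->
      map_mx intr (companionmx f) a b = (a.+1 == b)%:R :> R.
    by move=> al; rewrite !mxE ifN ?rmorph_nat.
  (* Column 0 has no predecessor; [drop_poly 0 f] is [f], which vanishes at [D]. *)
  have [b0|b0] := posnP b.
    rewrite b0 drop_poly0l fD mul0mx mxE big1 // => a /Ka->.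
    by rewrite b0 mulr0.
  have b1 : (b.-1 < (size f).-1)%N by apply: leq_ltn_trans (leq_pred _) (ltn_ord b).
  have bl : Ordinal b1 != Ordinal d0.
    rewrite -val_eqE /=; move: b0 (ltn_ord b); move: (size f) (nat_of_ord b) => q j.
    by lia.
  rewrite (bigD1 (Ordinal b1)) //= big1 => [|a /andP[/Ka-> ab]].
    by rewrite Ka // SE /= prednK // eqxx mulr1 addr0.
  rewrite (_ : a.+1 == b = false) ?mulr0 //; apply: contraNF ab => /eqP ab.
  by rewrite -val_eqE /= -ab.
have Eb := col_dual_krylov_mx D psi b.
rewrite E; have -> : (D *m dual_krylov_mx f D psi) i b =
    (D *m ipoly D (drop_poly b.+1 f) *m psi) i 0.
  by rewrite -mulmxA -Eb !mxE; apply: eq_bigr => k _; rewrite [col _ _ _ _]mxE.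
rewrite drop_polyS !rmorphD !rmorphM /= map_polyX horner_mx_X map_polyC /= horner_mx_C.
by rewrite mulmxDl mul_scalar_mx !mxE addrK.
Qed.

Lemma mul_dual_krylov_cV (R : realType) (n : nat) (f : {poly int}) (D : 'M[R]_n.+1)
    (psi : 'cV[R]_n.+1) (u : 'cV[int]_(size f).-1) :
  dual_krylov_mx f D psi *m map_mx intr u =
  ipoly D (\sum_b u b 0 *: drop_poly b.+1 f) *m psi.
Proof.
rewrite !rmorph_sum /= mulmx_suml; apply/colP => i; rewrite mxE summxE.
apply: eq_bigr => b _; rewrite ipolyZ -scalemxAl mulrC.
by rewrite [dual_krylov_mx _ _ _ _ _]mxE [map_mx _ _ _ _]mxE [RHS]mxE mulrC.
Qed.

(** The polynomials [drop_poly b.+1 f] are monic of distinct degrees, so the system is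
    triangular. *)
Lemma drop_poly_sum_eq0 (f : {poly int}) (u : 'cV[int]_(size f).-1) :
  f \is monic -> \sum_b u b 0 *: drop_poly b.+1 f = 0 -> u = 0.
Proof.
move=> fm sum0.
have f0 : (0 < size f)%N by rewrite size_poly_gt0 monic_neq0.
suff H k : forall b : 'I_(size f).-1, (b < k)%N -> u b 0 = 0.
  by apply/colP => b; rewrite mxE (H b.+1).
elim: k => // k IH b; rewrite ltnS leq_eqVlt => /predU1P[bk|]; last exact: IH.
have := congr1 (fun p : {poly int} => p`_((size f).-2 - b)) sum0.
have bd : ((size f).-2 - b + b.+1 = (size f).-1)%N.
  by move: (ltn_ord b); move: (size f) (nat_of_ord b) => q j; lia.
rewrite coef0 coef_sum (bigD1 b) //= big1 => [|c cb].
  by rewrite coefZ coef_drop_poly bd -/(lead_coef f) (monicP fm) mulr1 addr0.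
rewrite coefZ coef_drop_poly; case: (ltngtP c b) => [cb'|bc|cb'].
- by rewrite IH ?mul0r // -bk.
- rewrite [f`_ _]nth_default ?mulr0 //.
  by move: bd bc f0; move: (size f) (nat_of_ord b) (nat_of_ord c) => q j l; lia.
- by case/eqP: cb; exact: val_inj.
Qed.

(** The quotient (f(x) - f(y)) / (x - y) is the sum of the [drop_poly b.+1 f] in x times y^b; this
    is its value at y = x. *)
Lemma deriv_drop_poly (f : {poly int}) :
  \sum_(b < (size f).-1) drop_poly b.+1 f * 'X^b = f^`().
Proof.
apply/polyP => c; rewrite coef_deriv coef_sum.
under eq_bigr do rewrite coefMXn coef_drop_poly.
have [cd|dc] := ltnP c (size f).-1; last first.
  rewrite [f`_ _]nth_default ?mul0rn; last by move: dc; case: size.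
  rewrite big1 // => b _; case: ltnP => // bc; rewrite nth_default //.
  by move: dc bc; move: (size f) (nat_of_ord b) => q j; lia.
rewrite (bigID (fun b : 'I__ => (b <= c)%N)) /= [X in _ + X]big1 ?addr0; last first.
  by move=> b; rewrite -ltnNge => ->.
rewrite (eq_bigr (fun=> f`_c.+1)) => [|b bc].
  by rewrite -(big_ord_widen _ (fun=> f`_c.+1) cd) sumr_const card_ord.
by rewrite ltnNge bc /= addnS subnK.
Qed.

Lemma horner_mx_tr (R : comNzRingType) (n : nat) (A : 'M[R]_n.+1) (p : {poly R}) :
  horner_mx A^T p = (horner_mx A p)^T.
Proof.
elim/poly_ind: p => [|p c IH]; first by rewrite !rmorph0 trmx0.
rewrite !rmorphD !rmorphM /= !horner_mx_X !horner_mx_C IH linearD /= tr_scalar_mx.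
congr (_ + _); rewrite -[LHS]/(_ *m _) -trmx_mul; congr (_^T).
exact: comm_mx_horner.
Qed.

Lemma dual_krylov_mul_krylov (R : realType) (n : nat) (f : {poly int}) (D : 'M[R]_n.+1)
    (psi : 'cV[R]_n.+1) (v : 'rV[R]_n.+1) :
  dual_krylov_mx f D psi *m krylov_mx _ D v =
  \sum_(b < (size f).-1) ipoly D (drop_poly b.+1 f) *m (psi *m v) *m D ^+ b.
Proof.
apply/matrixP => i j; rewrite mxE summxE; apply: eq_bigr => b _.
rewrite mulmxA -[in RHS]mulmxA [RHS]mxE big_ord1.
by rewrite [dual_krylov_mx _ _ _ _ _]mxE [krylov_mx _ _ _ _ _]mxE.
Qed.

(** * Block matrices: outer products and entrywise maps *)

Lemma mulmx_sum_col_row (R : pzSemiRingType) (m n p : nat) (A : 'M[R]_(m, n)) (B : 'M[R]_(n, p)) :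
  A *m B = \sum_i col i A *m row i B.
Proof.
apply/matrixP => a b; rewrite mxE summxE; apply: eq_bigr => i _.
by rewrite mxE big_ord1 !mxE.
Qed.

Lemma map_mxrow (T U : Type) (g : T -> U) (k m : nat) (p_ : 'I_k -> nat)
    (B : forall i, 'M[T]_(m, p_ i)) :
  map_mx g (\mxrow_i B i) = \mxrow_i map_mx g (B i).
Proof. by apply/matrixP => a b; rewrite !mxE. Qed.

Lemma map_mxcol (T U : Type) (g : T -> U) (k n : nat) (p_ : 'I_k -> nat)
    (B : forall i, 'M[T]_(p_ i, n)) :
  map_mx g (\mxcol_i B i) = \mxcol_i map_mx g (B i).
Proof. by apply/matrixP => a b; rewrite !mxE. Qed.

Lemma map_mxdiag (V W : nmodType) (g : {additive V -> W}) (k : nat) (p_ : 'I_k -> nat)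
    (B : forall i, 'M[V]_(p_ i)) :
  map_mx g (\mxdiag_i B i) = \mxdiag_i map_mx g (B i).
Proof.
apply/matrixP => a b; rewrite [LHS]mxE ![(\mxdiag_i _) _ _]mxE.
by case: eqP => _; rewrite ?mxE ?raddf0 // -[0 in RHS](map_mx0 g) -map_conform_mx mxE.
Qed.

(** * Generic choice of the intertwiners *)

(** Each entry of the sum is a polynomial of degree at most 1 in t, and only countably many arise; a
    generic t is a root of none but the zero ones. *)
Lemma exists_generic_scalar (R : realType) (n : nat) (D : 'M[R]_n.+1) :
  exists t : R, forall p q : {poly int},
    ipoly D p + t *: ipoly D q = 0 -> ipoly D p = 0 /\ ipoly D q = 0.
Proof.
pose c (x : {poly int} * {poly int} * 'I_n.+1 * 'I_n.+1) : {poly R} :=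
  let: (p, q, a, b) := x in (ipoly D p a b)%:P + (ipoly D q a b) *: 'X.
have [t tP] := exists_common_nonroot c.
exists t => p q /matrixP E.
suff H a b : c (p, q, a, b) = 0.
  split; apply/matrixP => a b; rewrite [RHS]mxE; have /polyP cab := H a b.
    by have := cab 0%N; rewrite /c coefD coefC coefZ coefX coef0 mulr0 addr0.
  by have := cab 1%N; rewrite /c coefD coefC coefZ coefX coef0 mulr1 add0r.
apply/eqP/negPn/negP => /tP; rewrite /= !hornerE.
by have := E a b; rewrite !mxE mulrC => ->; rewrite eqxx.
Qed.

(* Psi = [Y | t Y] with t irrational, so that w Psi integral forces w Y = 0. *)
Lemma exists_generic_pair (R : realType) (n d : nat) (D : 'M[R]_n.+1)
    (P : nat -> 'M[R]_n.+1) :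
  \sum_(b < d) P b *m D ^+ b \in unitmx ->
  exists (V : 'M[R]_(n.+1 + n.+1, n.+1)) (Psi : 'M[R]_(n.+1, n.+1 + n.+1)),
    [/\ forall g : 'I_(n.+1 + n.+1) -> {poly int},
          \sum_i row i V *m ipoly D (g i) = 0 -> forall i, ipoly D (g i) = 0,
        forall h : 'I_(n.+1 + n.+1) -> {poly int},
          \sum_i ipoly D (h i) *m col i Psi = 0 -> forall i, ipoly D (h i) = 0,
        forall (w : 'rV[R]_n.+1) (y : 'rV[int]_(n.+1 + n.+1)),
          w *m Psi = map_mx intr y -> w = 0 &
        \sum_(b < d) P b *m (Psi *m V) *m D ^+ b \in unitmx].
Proof.
move=> Punit; have [t tP] := exists_generic_scalar D.
(* An index is a family of polynomial pairs together with one row of the vector identity to be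
   avoided; finite functions keep the index type countable. *)
pose cY (x : {ffun 'I_n.+1 -> {poly int} * {poly int}} * 'I_n.+1) : 'M[R]_n.+1 :=
  \matrix_(a, i) (ipoly D (x.1 i).1 + t *: ipoly D (x.1 i).2) x.2 a.
have [||Y Yu YP] := exists_generic_matrix cY (Phi := id) (V0 := 1%:M).
- by [].
- exact: unitmx1.
pose Psi := row_mx Y (t *: Y).
pose Phi (V : 'M[R]_(n.+1 + n.+1, n.+1)) := \sum_(b < d) P b *m (Psi *m V) *m D ^+ b.
pose cV (x : {ffun 'I_(n.+1 + n.+1) -> {poly int}} * 'I_n.+1) : 'M[R]_(n.+1 + n.+1, n.+1) :=
  \matrix_(i, a) ipoly D (x.1 i) a x.2.
(* At this base point [Psi *m V] is the identity, and [Phi] takes the value assumed invertible. *)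
have [||V Vu VP] := exists_generic_matrix cV (Phi := Phi) (V0 := col_mx (invmx Y) 0).
- move=> a x y; rewrite /Phi scaler_sumr -big_split /=; apply: eq_bigr => b _.
  by rewrite mulmxDr -scalemxAr mulmxDr mulmxDl -scalemxAr -scalemxAl.
- rewrite /Phi /Psi mul_row_col mulmxV // mulmx0 addr0.
  by under eq_bigr do rewrite mulmx1.
exists V, Psi; split=> //.
- move=> g gV i; suff H l : cV (finfun g, l) = 0.
    by apply/matrixP => a l; have /matrixP/(_ i a) := H l; rewrite !mxE ffunE.
  apply/eqP/negPn/negP => /VP /negP; apply; apply/eqP.
  have /rowP/(_ l) := gV; rewrite summxE [RHS]mxE => gVl; rewrite -[RHS]gVl; apply: eq_bigr => j _.
  by rewrite [RHS]mxE; apply: eq_bigr => a _; rewrite !mxE ffunE mulrC.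
- move=> h hPsi.
  pose hh : {ffun 'I_n.+1 -> {poly int} * {poly int}} :=
    [ffun i => (h (lshift _ i), h (rshift _ i))].
  have H i : ipoly D (h (lshift _ i)) + t *: ipoly D (h (rshift _ i)) = 0.
    suff H l : cY (hh, l) = 0.
      by apply/matrixP => l a; have /matrixP/(_ a i) := H l; rewrite !mxE ffunE.
    apply/eqP/negPn/negP => /YP /negP; apply; apply/eqP; rewrite exchange_big /=.
    have : \sum_j (ipoly D (h (lshift _ j)) + t *: ipoly D (h (rshift _ j))) *m col j Y = 0.
      rewrite -[RHS]hPsi big_split_ord /= -big_split /=; apply: eq_bigr => j _.
      rewrite mulmxDl -scalemxAl scalemxAr.
      have -> : col (lshift n.+1 j) Psi = col j Y by apply/colP => a; rewrite mxE row_mxEl [RHS]mxE.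
      have -> : col (rshift n.+1 j) Psi = t *: col j Y.
        by apply/colP => a; rewrite mxE row_mxEr !mxE.
      by [].
    move/colP/(_ l); rewrite summxE [RHS]mxE => suml; rewrite -[RHS]suml; apply: eq_bigr => j _.
    by rewrite [RHS]mxE; apply: eq_bigr => a _; rewrite [cY _ _ _]mxE ffunE [col _ _ _ _]mxE.
  move=> i; case: (splitP i) => j ij.
    have -> : i = lshift n.+1 j by apply/val_inj.
    by have [] := tP _ _ (H j).
  have -> : i = rshift n.+1 j by apply/val_inj.
  by have [] := tP _ _ (H j).
- move=> w y; rewrite mul_mx_row -[y]hsubmxK map_row_mx => /eq_row_mx[wY wtY].
  suff wY0 : w *m Y = 0 by apply: (can_inj (mulmxK Yu)); rewrite wY0 mul0mx.
  rewrite wY; apply/rowP => j; rewrite [RHS]mxE [LHS]mxE.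
  (* On constant polynomials the property of [t] is its irrationality. *)
  have := tP (- (rsubmx y 0 j))%:P (lsubmx y 0 j)%:P.
  have ty : t * (lsubmx y 0 j)%:~R = (rsubmx y 0 j)%:~R.
    have /rowP/(_ j) := wtY; rewrite -scalemxAr wY [LHS]mxE [X in _ * X]mxE => ->.
    by rewrite mxE.
  rewrite !map_polyC /= !horner_mx_C scale_scalar_mx -raddfD /= intrN ty addNr raddf0.
  by move=> [] // _ /matrixP/(_ 0 0); rewrite [LHS]mxE [RHS]mxE.
Qed.

(** * Self-similarity and integrality of the eigenvalues *)

Theorem theorem2 (R : realType) (n : nat) (A : 'M[R]_n) :
  (0 < n)%N ->
  diagonalizable (cplx_mx A) ->
  (exists (m : nat) (L : 'M[R]_(n + m)),
      [/\ (0 < m)%N, nonsingular L, generic_cps L & self_similarity L A])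
  <-> (forall z : R[i], eigenvalue (cplx_mx A) z -> algebraic_integer z).
Proof.
case: n A => // n A _ Adiag; split.
  move=> [m [L [_ L0 _ [_ [C [B LC]]]]]] z /eigenvalueP[v vA v0].
  exists (char_poly C); split; first exact: char_poly_monic.
  rewrite map_char_poly -eigenvalue_root_char; apply/eigenvalueP.
  have Lu : map_mx (real_complex R) L \in unitmx.
    by rewrite map_unitmx unitmxE unitfE.
  (* Padding [v] with zeros gives a left eigenvector of the block matrix; the invertible [L] carries
     it to [C]. *)
  exists (row_mx v 0 *m map_mx (real_complex R) L).
    have -> : map_mx intr C = map_mx (real_complex R) (map_mx intr C).
      by rewrite -map_mx_comp; apply: eq_map_mx => x; rewrite /= rmorph_int.
    rewrite -mulmxA -map_mxM -LC map_mxM mulmxA map_block_mx !map_mx0.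
    by rewrite mul_row_block !mulmx0 !mul0mx !addr0 vA scalemxAl scale_row_mx scaler0.
  apply: contraNneq v0 => /(canRL (mulmxK Lu)); rewrite mul0mx -(row_mx0 _ 1 n.+1 m).
  by move=> /eq_row_mx[->].
move=> Aint; have [f [fm fA fmin fsep]] := integral_minimal_poly Adiag Aint.
pose D := A^T; have DE p : ipoly D p = (ipoly A p)^T by rewrite horner_mx_tr.
have fD : ipoly D f = 0 by rewrite DE fA trmx0.
have f_gt0 : (0 < size f)%N by rewrite size_poly_gt0 monic_neq0.
have fminD (g : {poly int}) : (size g <= (size f).-1)%N -> ipoly D g = 0 -> g = 0.
  move=> gf gD; apply: fmin; first by rewrite -(prednK f_gt0) ltnS.
  by apply: (can_inj trmxK); rewrite -DE trmx0.
have sizef : (0 < (size f).-1)%N.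
  rewrite lt0n; apply/eqP => sf; have : (1 : {poly int}) = 0; last by move/eqP; rewrite oner_eq0.
  have f1 : f = 1.
    have sf1 : size f = 1 by rewrite -(prednK f_gt0) sf.
    have := monicP fm; rewrite lead_coefE sf1 /= => f00.
    by rewrite [f]size1_polyC ?sf1 // f00.
  by move: fA; rewrite f1 !rmorph1 => /eqP; rewrite oner_eq0.
pose P b := ipoly D (drop_poly b.+1 f).
have Punit : \sum_(b < (size f).-1) P b *m D ^+ b \in unitmx.
  (* Euler's identity turns the sum into f'(D), invertible by separability. *)
  suff -> : \sum_(b < (size f).-1) P b *m D ^+ b = ipoly D f^`().
    by rewrite DE unitmx_tr.
  rewrite -deriv_drop_poly !rmorph_sum /=; apply: eq_bigr => b _.
  by rewrite !rmorphM /= map_polyXn rmorphXn /= horner_mx_X.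
have [V [Psi [Vgen Psigen Psi_int PVunit]]] := exists_generic_pair Punit.
pose k := (n.+1 + n.+1)%N; pose d := (size f).-1.
pose S (i : 'I_k) := dual_krylov_mx f D (col i Psi).
pose H (i : 'I_k) := krylov_mx d D (row i V).
suff : exists m, (0 < m)%N /\ exists L : 'M[R]_(n.+1 + m),
    [/\ nonsingular L, generic_cps L & self_similarity L A].
  by move=> [m [m0 [L [L0 Lgen LA]]]]; exists m, L.
(* Written as a sum to match the size of [\mxdiag]. *)
pose s := (\sum_(i < k) d)%N.
pose m := (s - n.+1)%N.
have s_gt : (n.+1 < s)%N.
  rewrite /s sum_nat_const card_ord -[ltnLHS]muln1 (@leq_trans (k * 1)) ?leq_mul //.
  by rewrite ltn_pmul2r // /k -[ltnLHS]addn0 ltn_add2l.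
have sE : s = (n.+1 + m)%N by rewrite subnKC // ltnW.
exists m; split; first by rewrite subn_gt0.
suff [C [pi [sg [piC sgC sgpi [pi_inj sg_im sg_int]]]]] :
    exists (C : 'M[int]_s) (pi : 'M[R]_(s, n.+1)) (sg : 'M[R]_(n.+1, s)),
    [/\ map_mx intr C *m pi = pi *m A^T,
        sg *m map_mx intr C = A^T *m sg,
        sg *m pi \in unitmx &
        [/\ forall r : 'rV[int]_s, map_mx intr r *m pi = 0 -> r = 0,
            forall (r : 'rV[int]_s) (w : 'rV[R]_n.+1), map_mx intr r = w *m sg -> r = 0 &
            forall u : 'cV[int]_s, sg *m map_mx intr u = 0 -> u = 0]].
  move: C pi sg piC sgC sgpi pi_inj sg_im sg_int; rewrite sE => C pi sg.
  exact: scheme_of_intertwiners.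
exists (\mxdiag_(i < k) companionmx f), (\mxcol_(i < k) H i), (\mxrow_(i < k) S i).
have mapC : map_mx intr (\mxdiag_(i < k) companionmx f) =
    \mxdiag_(i < k) map_mx intr (companionmx f) :> 'M[R]_s.
  exact: map_mxdiag.
rewrite mapC; split.
- rewrite mul_mxdiag_mxcol mxcol_mul; apply: eq_mxcol => i.
  exact: companion_krylov.
- rewrite mul_mxrow_mxdiag mul_mxrow; apply: eq_mxrow => i.
  exact: dual_krylov_companion.
(* Summing over the blocks assembles the rank-one products of columns of [Psi] and rows of [V] into
   [Psi *m V]. *)
- rewrite mul_mxrow_mxcol; under eq_bigr do rewrite dual_krylov_mul_krylov.
  rewrite exchange_big /=; under eq_bigr do rewrite -mulmx_suml -mulmx_sumr.
  by rewrite -mulmx_sum_col_row.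
- split.
  + move=> r; rewrite -[r]submxrowK map_mxrow mul_mxrow_mxcol.
    under eq_bigr do rewrite mul_rV_krylov.
    move=> /Vgen r0; rewrite -[RHS]mxrow0; apply: eq_mxrow => i.
    rewrite -[LHS]rVpolyK (fminD (rVpoly _)) ?linear0 //; exact: size_poly.
  + move=> r w; rewrite -[r]submxrowK map_mxrow mul_mxrow => /eq_mxrowP rw.
    (* As [f] is monic, the last column of each [S i] is [col i Psi], so the last entries of the
       blocks of [r] form [w *m Psi], which is thus integral. *)
    have last_lt : (d.-1 < d)%N by rewrite ltn_predL.
    pose last := Ordinal last_lt.
    suff w0 : w = 0.
      rewrite -[RHS]mxrow0; apply: eq_mxrow => i; apply/matrixP => a b.
      have /matrixP/(_ a b) := rw i; rewrite w0 mul0mx mxE [RHS]mxE => /eqP.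
      by rewrite intr_eq0 => /eqP->; rewrite mxE.
    apply: (Psi_int w (\row_i submxrow r i 0 last)).
    apply/rowP => i; rewrite [RHS]mxE [(\row__ _) _ _]mxE.
    have /matrixP/(_ 0 last) := rw i; rewrite [LHS]mxE => ->.
    rewrite !mxE; apply: eq_bigr => a _; congr (_ * _).
    by rewrite mxE /= prednK // drop_poly_monic // !rmorph1 [1 *m _]mul1mx mxE.
  + move=> u; rewrite -[u]submxcolK map_mxcol mul_mxrow_mxcol.
    under eq_bigr do rewrite mul_dual_krylov_cV.
    move=> /Psigen u0; rewrite -[RHS]mxcol0; apply: eq_mxcol => i.
    (* Each [drop_poly b.+1 f] has size at most [d], so minimality of [f] applies to their
       combination. *)
    apply: drop_poly_sum_eq0 => //; apply: fminD (u0 i).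
    apply: leq_trans (size_sum _ _ _) _; apply/bigmax_leqP => b _.
    apply: leq_trans (size_scale_leq _ _) _; rewrite size_drop_poly.
    by rewrite -[X in (X - _)%N](prednK f_gt0) subSS leq_subr.
Qed.
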